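(* Let $\alpha=(\alpha_1,\dots,\alpha_d)$ be a probability distribution on $[d]$ with $\alpha_1\ge\alpha_2\ge\cdots\ge\alpha_d$, let $n\in\mathbb N$, and let $\lambda\sim\mathrm{SW}^n(\alpha)$. Then for every $k\in[d]$, \[ \alpha_k n-2\sqrt{\alpha_k k\, n}\;\le\;\mathbb E[\lambda_k]\;\le\;\alpha_k n+2\sqrt{(\alpha_k+\alpha_{k+1}+\cdots+\alpha_d)\,n}. \] In particular, writing $\nu_k=\min\{1,\alpha_k d\}$, one has $\alpha_k n-2\sqrt{\nu_k n}\le \mathbb E[\lambda_k]\le \alpha_k n+2\sqrt{\nu_k n}$.
   Context: For a word $w\in[d]^n$, a (weakly) increasing subsequence is $(w_{i_1},\dots,w_{i_\ell})$ with $i_1<\cdots<i_\ell$ and $w_{i_1}\le\cdots\le w_{i_\ell}$. The RSK shape $\lambda=\mathrm{shRSK}(w)$ is the Young diagram $\lambda_1\ge\lambda_2\ge\cdots\ge\lambda_d\ge0$, $\sum_i\lambda_i=n$, produced by the Robinson–Schensted–Knuth algorithm; equivalently (Greene's theorem) $\lambda_1+\cdots+\lambda_k$ equals the maximum total length of a union of $k$ disjoint weakly increasing subsequences of $w$. For a probability distribution $\alpha$ on $[d]$, the Schur–Weyl distribution $\mathrm{SW}^n(\alpha)$ is the law of $\mathrm{shRSK}(\boldsymbol w)$ where $\boldsymbol w\in[d]^n$ has i.i.d. letters drawn from $\alpha$. *)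

(* Defs.v *)
From HB Require Import structures.
From mathcomp Require Import all_boot all_order all_algebra.
Set Implicit Arguments. Unset Strict Implicit. Unset Printing Implicit Defensive.
Import Order.TTheory GRing.Theory Num.Theory.

(* Robinson-Schensted-Knuth row insertion on semistandard tableaux,
   represented as a list of rows (each row a weakly increasing seq nat).
   Inserting x into a row: x bumps the leftmost entry strictly greater
   than x (weak-increase / RSK convention); if none, x is appended. *)
Fixpoint rowins (x : nat) (t : seq (seq nat)) : seq (seq nat) :=
  match t with
  | [::] => [:: [:: x]]
  | r :: t' =>
      let i := find (fun y => x < y) r in
      if i == size r then rcons r x :: t'
      else set_nth 0 r i x :: rowins (nth 0 r i) t'
  end.

Definition RSK_P (w : seq nat) : seq (seq nat) :=
  foldl (fun t x => rowins x t) [::] w.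

Definition shRSK (w : seq nat) : seq nat := map size (RSK_P w).

(* lambda_{k+1} (0-based index k), zero beyond the number of rows *)
Definition shRSK_part (w : seq nat) (k : nat) : nat := nth 0 (shRSK w) k.

(* a word in [d]^n, letters 'I_d (letter i stands for i+1) *)
Definition word_nat d n (w : n.-tuple 'I_d) : seq nat := map val (val w).

Definition word_prob (R : nzRingType) d n (alpha : 'I_d -> R) (w : n.-tuple 'I_d) : R :=
  \prod_(i < n) alpha (tnth w i).

Definition SW_exp_part (R : nzRingType) d n (alpha : 'I_d -> R) (k : nat) : R :=
  \sum_(w : n.-tuple 'I_d) word_prob alpha w * (shRSK_part (word_nat w) k)%:R.

(* Main.v *)
Require Import Defs.
From HB Require Import structures.
From mathcomp Require Import all_boot all_order all_algebra.
From mathcomp Require Import zify ring lra.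
Import Order.TTheory GRing.Theory Num.Theory.
Set Implicit Arguments. Unset Strict Implicit. Unset Printing Implicit Defensive.

(* A word is Knuth equivalent to the reading word of its tableau [P], whose row
   [k] is weakly increasing with all letters at least [k]. Hence [lambda_k] is at
   most the longest weakly increasing subsequence of the letters [>= k], and at
   least the number of disjoint chains [k, k-1, ..., 0] found greedily, i.e. the
   number of departures from a tandem queue in which letter [k] is an arrival and
   letter [i < k] a service at queue [i]: both statistics are computed by
   automata satisfying the Knuth relations. Both automata have product geometric
   invariant laws, once a sink letter of rate [theta > alpha k] is added to the
   first one, and the arrivals of the second one are thinned to a rate
   [b < alpha k]. Comparing the empty start with the stationary one gives
     E[lambda_k] <= theta n + sum_(j >= k) alpha j / (theta - alpha j),
     E[lambda_k] >= b n - sum_(j < k) b / (alpha j - b),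
   and it remains to optimize [theta - alpha k] and [alpha k - b]. *)

(** * Knuth equivalence and row insertion *)

Inductive knuth : seq nat -> seq nat -> Prop :=
| knuth_refl u : knuth u u
| knuth_trans u v w : knuth u v -> knuth v w -> knuth u w
| knuth_left p s x y z : x < y -> y <= z ->
    knuth (p ++ [:: y; z; x] ++ s) (p ++ [:: y; x; z] ++ s)
| knuth_right p s x y z : x <= y -> y < z ->
    knuth (p ++ [:: x; z; y] ++ s) (p ++ [:: z; x; y] ++ s).

Lemma knuth_cat p s u v : knuth u v -> knuth (p ++ u ++ s) (p ++ v ++ s).
Proof.
elim=> [w|? ? ? _ IH1 _|p' s' x y z xy yz|p' s' x y z xy yz].
- exact: knuth_refl.
- exact: knuth_trans.
- by rewrite -!catA !(catA p); apply: knuth_left.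
- by rewrite -!catA !(catA p); apply: knuth_right.
Qed.

(** The letter [x], smaller than the whole sorted row, hops left over its entries one at a time; the
    entry preceding the one hopped over is the witness that [knuth_left] requires. *)
Lemma knuth_move_left x y r : x < y -> sorted leq (y :: r) ->
  knuth (y :: rcons r x) (y :: x :: r).
Proof.
elim: r y => [|z r IH] y xy /=; first by move=> _; exact: knuth_refl.
move=> /andP[yz zr]; apply: (@knuth_trans _ (y :: z :: x :: r)).
  have := knuth_cat [:: y] [::] (IH z (leq_trans xy yz) zr).
  by rewrite !cats0.
exact: (@knuth_left [::] r).
Qed.

(** Here [y] hops left over the entries of [r]. Each hop over [u] is witnessed by the letter that
    follows, which lies between [u] and [y]. *)
Lemma knuth_move_right x y r : x < y -> sorted leq (rcons r x) ->
  knuth (rcons (rcons r y) x) (y :: rcons r x).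
Proof.
elim/last_ind: r x => [|r u IH] x xy; first by move=> _; exact: knuth_refl.
rewrite -cats1 -[rcons r u]cats1 -catA /= sorted_cat_cons => /andP[ru].
rewrite /= andbT => ux.
apply: (@knuth_trans _ (r ++ [:: y; u; x])).
  have := @knuth_right r [::] u x y ux xy.
  by rewrite -!cats1 -!catA.
have := knuth_cat [::] [:: x] (IH u (leq_ltn_trans ux xy) ru).
by rewrite -!cats1 /= -!catA.
Qed.

(** A bump has two phases: [x] travels left until it stands just after the letter [y] that it bumps,
    then [y] travels left out of the row. *)
Lemma knuth_rowins_row x r : sorted leq r ->
  let i := find (fun y => x < y) r in i < size r ->
  knuth (rcons r x) (nth 0 r i :: set_nth 0 r i x).
Proof.
move=> rs i ir; have hr : has (fun y => x < y) r by rewrite has_find.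
set y := nth 0 r i.
have xy : x < y by exact: (nth_find 0 hr).
have Er : r = take i r ++ y :: drop i.+1 r by rewrite -drop_nth // cat_take_drop.
have le_x : all (fun u => u <= x) (take i r).
  apply/(all_nthP 0) => j; rewrite size_take ir => ji.
  by rewrite nth_take // leqNgt; rewrite (before_find 0 ji).
have -> : set_nth 0 r i x = take i r ++ x :: drop i.+1 r by rewrite set_nthE ir.
move: rs; move: (take i r) (drop i.+1 r) le_x Er => p s px ->.
rewrite sorted_cat_cons => /andP[pys ys].
apply: (@knuth_trans _ (p ++ y :: x :: s)).
  rewrite rcons_cat /=.
  by have := knuth_cat p [::] (knuth_move_left xy ys); rewrite !cats0.
have prx : sorted leq (rcons p x).
  case: p px pys => //= u p /andP[ux px].
  rewrite !rcons_path => /andP[-> _] /=.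
  by have /allP := px; case: (lastP p) => // p' v /(_ v); rewrite last_rcons mem_rcons in_cons eqxx; apply.
by have := knuth_cat [::] s (knuth_move_right xy prx); rewrite /= -!cats1 -!catA.
Qed.

(** The column condition is kept in the form that row [i] has letters at least [i]. Insertion
    preserves this because a bumped letter strictly exceeds the letter that bumps it. *)
Fixpoint tab_inv (i : nat) (t : seq (seq nat)) : bool :=
  if t is r :: t' then [&& sorted leq r, all (leq i) r & tab_inv i.+1 t'] else true.

Lemma sorted_bump x r : sorted leq r ->
  sorted leq (set_nth 0 r (find (fun y => x < y) r) x).
Proof.
elim: r => //= y r IH yr; case: ifP => /= xy.
  by case: r yr {IH} => //= z r /andP[yz ->]; rewrite (leq_trans (ltnW xy) yz).
move: IH; rewrite (path_sorted yr) => /(_ isT).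
case: r yr => [|z r] /=; first by rewrite leqNgt xy.
case: ifP => /= xz /andP[yz zr] -> //; last by rewrite yz.
by rewrite leqNgt xy.
Qed.

Lemma sorted_append x r : sorted leq r ->
  find (fun y => x < y) r = size r -> sorted leq (rcons r x).
Proof.
move=> rs fr; have hr : ~~ has (fun y => x < y) r by rewrite has_find fr ltnn.
case: r rs hr {fr} => //= y r yr; rewrite negb_or => /andP[yx hr].
rewrite rcons_path yr /=.
case: (lastP r) hr => [|r' v]; first by rewrite leqNgt.
by rewrite last_rcons has_rcons negb_or -leqNgt => /andP[].
Qed.

Lemma rowins_inv i x t : i <= x -> tab_inv i t -> tab_inv i (rowins x t).
Proof.
elim: t i x => [|r t IH] i x ix /=; first by rewrite ix.
case/and3P=> rs ri ti; case: ifP => [/eqP fr|fr] /=.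
  by rewrite sorted_append // all_rcons ix ri ti.
have lt_f : find (fun y => x < y) r < size r by rewrite ltn_neqAle fr find_size.
rewrite sorted_bump //=; apply/andP; split.
  apply/allP => y /(nthP 0)[j jr <-]; rewrite nth_set_nth /=; case: eqP => // _.
  have : j < size r by move: jr; rewrite size_set_nth (maxn_idPr lt_f).
  by move/(all_nthP 0): ri; apply.
apply: IH ti; apply: (leq_ltn_trans ix).
by apply: (@nth_find _ 0 (fun y => x < y)); rewrite has_find.
Qed.

(** Rows are read from the bottom up, so that a letter leaving a row on its left arrives at the
    right end of the rows below, where it is inserted next. *)
Definition reading (t : seq (seq nat)) : seq nat := flatten (rev t).

Lemma reading_cons r t : reading (r :: t) = reading t ++ r.
Proof. by rewrite /reading rev_cons flatten_rcons. Qed.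

Lemma knuth_rowins i x t : tab_inv i t ->
  knuth (rcons (reading t) x) (reading (rowins x t)).
Proof.
elim: t i x => [|r t IH] i x /=; first by move=> _; exact: knuth_refl.
case/and3P=> rs _ ti; rewrite reading_cons rcons_cat.
case: ifP => [_|fr]; first by rewrite reading_cons; exact: knuth_refl.
have lt_f : find (fun y => x < y) r < size r by rewrite ltn_neqAle fr find_size.
rewrite reading_cons.
apply: (@knuth_trans _ (rcons (reading t) (nth 0 r (find (fun y => x < y) r))
   ++ set_nth 0 r (find (fun y => x < y) r) x)).
  have := knuth_cat (reading t) [::] (knuth_rowins_row rs lt_f).
  by rewrite !cats0 cat_rcons.
exact: (knuth_cat [::] _ (IH _ _ ti)).
Qed.

Lemma RSK_P_rcons w x : RSK_P (rcons w x) = rowins x (RSK_P w).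
Proof. by rewrite /RSK_P -cats1 foldl_cat. Qed.

Lemma RSK_P_inv w : tab_inv 0 (RSK_P w).
Proof.
by elim/last_ind: w => // w x IH; rewrite RSK_P_rcons rowins_inv.
Qed.

Lemma knuth_RSK_P w : knuth w (reading (RSK_P w)).
Proof.
elim/last_ind: w => [|w x IH]; first exact: knuth_refl.
rewrite RSK_P_rcons; apply: knuth_trans (knuth_rowins x (RSK_P_inv w)).
by have := knuth_cat [::] [:: x] IH; rewrite !cats1.
Qed.

(** * Longest increasing subsequences and greedy chains *)

Definition nondecr (f : nat -> nat) := forall i, f i <= f i.+1.

Lemma nondecr_le f i j : nondecr f -> i <= j -> f i <= f j.
Proof.
move=> ff; elim: j => [|j IH]; first by case: i.
rewrite leq_eqVlt => /orP[/eqP->//|ij]; exact: leq_trans (IH ij) (ff j).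
Qed.

Section Machine.
Variable act : (nat -> nat) -> nat -> nat -> nat.
Hypothesis act_nondecr : forall f x, nondecr f -> nondecr (act f x).
Hypothesis act_le : forall f g x,
  (forall j, f j <= g j) -> forall j, act f x j <= act g x j.
Hypothesis act_add : forall c f x j, act (fun j => c + f j) x j = c + act f x j.
Hypothesis act_left : forall f x y z j, nondecr f -> x < y -> y <= z ->
  foldl act f [:: y; z; x] j = foldl act f [:: y; x; z] j.
Hypothesis act_right : forall f x y z j, nondecr f -> x <= y -> y < z ->
  foldl act f [:: x; z; y] j = foldl act f [:: z; x; y] j.

Lemma run_le w f g : (forall j, f j <= g j) ->
  forall j, foldl act f w j <= foldl act g w j.
Proof.
by elim: w f g => [|x w IH] f g fg //=; apply: IH; apply: act_le.
Qed.

(** Monotonicity applied in both directions gives extensionality, so states need only be compared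
    pointwise. *)
Lemma run_eq w f g : f =1 g -> foldl act f w =1 foldl act g w.
Proof.
by move=> fg j; apply/eqP; rewrite eqn_leq !run_le // => i; rewrite fg.
Qed.

Lemma run_add c w f j : foldl act (fun j => c + f j) w j = c + foldl act f w j.
Proof.
elim: w f => [|x w IH] f //=; rewrite -IH; apply: run_eq => i; exact: act_add.
Qed.

Lemma run_nondecr w f : nondecr f -> nondecr (foldl act f w).
Proof. by elim: w f => [|x w IH] f ff //=; apply: IH; apply: act_nondecr. Qed.

(** The local relations hold on nondecreasing states only; the prefix [p] preserves this property,
    and the suffix [s] preserves equality. *)
Lemma run_knuth u v f : knuth u v -> nondecr f -> foldl act f u =1 foldl act f v.
Proof.
move=> uv ff; elim: uv => {u v} [u//|u v w _ IH1 _ IH2 j|p s x y z xy yz|p s x y z xy yz].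
- by rewrite IH1 IH2.
- rewrite !foldl_cat; apply: run_eq => j; apply: act_left => //; exact: run_nondecr.
- rewrite !foldl_cat; apply: run_eq => j; apply: act_right => //; exact: run_nondecr.
Qed.

End Machine.

(* [G j] is the longest weakly increasing subsequence of letters in [[k, j)]. *)
Definition lis_act (k : nat) (G : nat -> nat) (x : nat) : nat -> nat :=
  fun j => if (k <= x) && (x < j) then maxn (G j) (G x.+1).+1 else G j.

Lemma lis_nondecr k G x : nondecr G -> nondecr (lis_act k G x).
Proof.
move=> GG i; have := GG i; rewrite /lis_act.
have [->|xi] := eqVneq x i; do ![case: ifP => ?]; lia.
Qed.

Lemma lis_le k G H x :
  (forall j, G j <= H j) -> forall j, lis_act k G x j <= lis_act k H x j.
Proof.
by move=> GH j; rewrite /lis_act; case: ifP => // _; have := GH j; have := GH x.+1; lia.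
Qed.

Lemma lis_left k G x y z j : nondecr G -> x < y -> y <= z ->
  foldl (lis_act k) G [:: y; z; x] j = foldl (lis_act k) G [:: y; x; z] j.
Proof.
move=> GG xy yz /=; rewrite /lis_act.
have Gxy : G x.+1 <= G y.+1 by apply: nondecr_le => //; lia.
have Gyz : G y.+1 <= G z.+1 by apply: nondecr_le => //; lia.
do ![case: ifP => ?]; lia.
Qed.

Lemma lis_right k G x y z j : nondecr G -> x <= y -> y < z ->
  foldl (lis_act k) G [:: x; z; y] j = foldl (lis_act k) G [:: z; x; y] j.
Proof.
move=> GG xy yz /=; rewrite /lis_act.
have Gxy : G x.+1 <= G y.+1 by apply: nondecr_le => //; lia.
have Gyz : G y.+1 <= G z.+1 by apply: nondecr_le => //; lia.
do ![case: ifP => ?]; lia.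
Qed.

(* [X j] counts the chains [k, k-1, ...] that have already reached letter [j]. *)
Definition chain_act (k : nat) (X : nat -> nat) (x : nat) : nat -> nat :=
  fun j => if x == k then (if k <= j then (X j).+1 else X j)
           else if (x < k) && (j == x) then minn (X j).+1 (X j.+1) else X j.

Lemma chain_nondecr k X x : nondecr X -> nondecr (chain_act k X x).
Proof.
move=> XX i; have := XX i; have := XX i.+1; rewrite /chain_act.
do ![case: ifP => ?]; lia.
Qed.

Lemma chain_le k X Y x :
  (forall j, X j <= Y j) -> forall j, chain_act k X x j <= chain_act k Y x j.
Proof.
move=> XY j; have := XY j; have := XY j.+1; rewrite /chain_act.
do ![case: ifP => ?]; lia.
Qed.

Lemma chain_add k c X x j :
  chain_act k (fun j => c + X j) x j = c + chain_act k X x j.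
Proof. rewrite /chain_act; do ![case: ifP => ?]; lia. Qed.

Lemma chain_left k X x y z j : nondecr X -> x < y -> y <= z ->
  foldl (chain_act k) X [:: y; z; x] j = foldl (chain_act k) X [:: y; x; z] j.
Proof.
move=> XX xy yz /=; rewrite /chain_act.
have := XX j; have := XX j.+1; have := XX j.+2.
do ![case: ifP => ?]; lia.
Qed.

Lemma chain_right k X x y z j : nondecr X -> x <= y -> y < z ->
  foldl (chain_act k) X [:: x; z; y] j = foldl (chain_act k) X [:: z; x; y] j.
Proof.
move=> XX xy yz /=; rewrite /chain_act.
have := XX j; have := XX j.+1; have := XX j.+2.
do ![case: ifP => ?]; lia.
Qed.

(** * Comparison of [lambda_k] with the two statistics *)

Lemma knuth_all (P : pred nat) u v : knuth u v -> all P u = all P v.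
Proof.
elim=> {u v} [//|u v w _ -> _ //|p s x y z _ _|p s x y z _ _];
  by rewrite !all_cat /= andbT; do ![case: (P _) => //=]; rewrite ?andbF.
Qed.

Lemma tab_inv_ge i t : tab_inv i t -> all (leq i) (reading t).
Proof.
elim: t i => //= r t IH i /and3P[_ ri ti]; rewrite reading_cons all_cat ri andbT.
by apply: sub_all (IH _ ti) => x; apply: ltnW.
Qed.

Lemma tab_inv_row i t j : tab_inv i t ->
  sorted leq (nth [::] t j) && all (leq (i + j)) (nth [::] t j).
Proof.
elim: t i j => [|r t IH] i j /=; first by rewrite nth_nil.
case/and3P=> rs ri ti; case: j => [|j] /=; first by rewrite addn0 rs ri.
by rewrite addnS -addSn; apply: IH.
Qed.

Lemma readingE t j : exists u v, reading t = u ++ nth [::] t j ++ v.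
Proof.
elim: t j => [|r t IH] j; first by exists [::], [::]; rewrite nth_nil.
case: j => [|j]; first by exists (reading t), [::]; rewrite cats0 reading_cons.
by have [u [v E]] := IH j; exists u, (v ++ r); rewrite reading_cons E -!catA.
Qed.

Lemma lis_run_ge k w G j : G j <= foldl (lis_act k) G w j.
Proof.
elim: w G => [|x w IH] G //=; apply: leq_trans (IH _).
by rewrite /lis_act; case: ifP => // _; lia.
Qed.

Lemma lis_run_sorted k r G j : nondecr G -> sorted leq r -> all (leq k) r ->
  all (fun x => x < j) r -> size r <= foldl (lis_act k) G r j.
Proof.
move=> GG; elim/last_ind: r j => [|r x IH] j //.
rewrite !all_rcons size_rcons -cats1 foldl_cat /= => rs /andP[kx kr] /andP[xj rj].
have rx : all (fun y => y < x.+1) r.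
  move: rs; rewrite (sorted_pairwise leq_trans) pairwise_cat => /andP[+ _].
  by rewrite allrel1r.
have rs' : sorted leq r by case/cat_sorted2: rs.
by have := IH _ rs' kr rx; rewrite {2}/lis_act kx xj /=; lia.
Qed.

(** Row [k] is a contiguous factor of the reading word: the letters before it leave a nondecreasing
    state, and those after it cannot lower the count. *)
Lemma shRSK_part_le_lis d k w : all (fun x => x < d) w ->
  shRSK_part w k <= foldl (lis_act k) (fun=> 0) w d.
Proof.
move=> wd; have kn := knuth_RSK_P w.
have nd0 : nondecr (fun=> 0) by [].
rewrite (run_knuth (@lis_nondecr k) (@lis_le k) (@lis_left k) (@lis_right k) kn nd0).
move: wd; rewrite (knuth_all _ kn) /shRSK_part /shRSK => wd.
have /andP[rs rk] := tab_inv_row k (RSK_P_inv w).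
rewrite add0n in rk; move: rs rk; have [u [v E]] := readingE (RSK_P w) k.
have -> : nth 0 [seq size i | i <- RSK_P w] k = size (nth [::] (RSK_P w) k).
  have [kt|kt] := ltnP k (size (RSK_P w)); first exact: nth_map.
  by rewrite !nth_default ?size_map.
move: wd; rewrite E !all_cat !foldl_cat => /and3P[_ rd _] rs rk.
apply: leq_trans (lis_run_ge _ _ _ _); apply: lis_run_sorted => //.
apply: run_nondecr => //; exact: lis_nondecr.
Qed.

Lemma chain_run_lt k w X i j : all (leq i) w -> j < i ->
  foldl (chain_act k) X w j = X j.
Proof.
elim: w X => [|x w IH] X //= /andP[ix iw] ji; rewrite IH // /chain_act.
do ![case: ifP => ?]; lia.
Qed.

Lemma chain_run_top k w X : foldl (chain_act k) X w k <= X k + size w.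
Proof.
elim: w X => [|x w IH] X /=; first by rewrite addn0.
apply: leq_trans (IH _) _; rewrite /chain_act; do ![case: ifP => ?]; lia.
Qed.

(** In a sorted row with letters at least [i], every [i] precedes every [i.+1]. So while entry [i]
    is being raised, its cap is still the initial [X i.+1]. *)
Lemma chain_run_row k r X i : i < k -> sorted leq r -> all (leq i) r ->
  foldl (chain_act k) X r i <= maxn (X i) (X i.+1).
Proof.
move=> ik; elim: r X => [|x r IH] X /=; first by rewrite leq_maxl.
move=> xr /andP[ix ir]; have [->|xi] := eqVneq x i.
  apply: leq_trans (IH _ (path_sorted xr) ir) _.
  rewrite /chain_act; do ![case: ifP => ?]; lia.
have ir' : all (leq i.+1) r.
  have xi' : i < x by lia.
  apply/allP => y yr; apply: leq_trans xi' _.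
  by move: xr; rewrite (path_sortedE leq_trans) => /andP[/allP + _]; apply.
rewrite (chain_run_lt _ _ ir') // /chain_act; do ![case: ifP => ?]; lia.
Qed.

(** The rows below are read first and have letters above [i], so entry [i] is still 0 when its row
    starts. That row then caps it by entry [i.+1], bounded by induction, down to row [k], whose size
    bounds the number of letters [k] in it. *)
Lemma chain_run_reading k i t : tab_inv i t -> i <= k ->
  foldl (chain_act k) (fun=> 0) (reading t) i <= size (nth [::] t (k - i)).
Proof.
elim: t i => [//|r t IH] i /= /and3P[rs ri ti] ik.
rewrite reading_cons foldl_cat.
have X0 : foldl (chain_act k) (fun=> 0) (reading t) i = 0.
  exact: chain_run_lt (tab_inv_ge ti) _.
move: ik; rewrite leq_eqVlt => /orP[/eqP ik|ik].
  by subst k; rewrite subnn /=; apply: leq_trans (chain_run_top _ _ _) _; rewrite X0.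
apply: leq_trans (chain_run_row _ ik rs ri) _; rewrite X0 max0n.
by rewrite -(subnSK ik) /=; apply: IH.
Qed.

Lemma chain_le_shRSK_part k w :
  foldl (chain_act k) (fun=> 0) w 0 <= shRSK_part w k.
Proof.
have nd0 : nondecr (fun=> 0) by [].
rewrite (run_knuth (@chain_nondecr k) (@chain_le k) (@chain_left k)
  (@chain_right k) (knuth_RSK_P w) nd0).
apply: leq_trans (chain_run_reading (RSK_P_inv w) _) _ => //.
rewrite subn0 /shRSK_part /shRSK.
have [kt|kt] := ltnP k (size (RSK_P w)); first by rewrite (nth_map [::]).
by rewrite !nth_default ?size_map.
Qed.

(** * The increasing subsequence automaton in multiplicity coordinates *)

(* The first row of the tableau as a list of letter multiplicities; the second
   component counts the insertions that lengthened the row. *)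
Fixpoint row_bump (cs : seq nat) (a : nat) : seq nat * nat :=
  if cs is c :: cs' then
    if c is c'.+1 then (c' :: cs', a)
    else ((0 :: (row_bump cs' a).1), (row_bump cs' a).2)
  else ([::], a.+1).

Fixpoint row_ins (x : nat) (cs : seq nat) (a : nat) : seq nat * nat :=
  if cs is c :: cs' then
    if x is x'.+1 then (c :: (row_ins x' cs' a).1, (row_ins x' cs' a).2)
    else (c.+1 :: (row_bump cs' a).1, (row_bump cs' a).2)
  else ([::], a).

Definition row_step (k : nat) (p : seq nat * nat) (x : nat) :=
  if k <= x then row_ins x p.1 p.2 else p.

(** Partial sums turn multiplicities into states of [lis_act], and queue lengths into states of
    [chain_act]. The offset [z] lets inductions peel off the head of the list. *)
Definition psum (z : nat) (cs : seq nat) (j : nat) : nat := z + sumn (take j cs).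

Lemma sumn_take_nseq0 j n : sumn (take j (nseq n 0)) = 0.
Proof. by elim: n j => [|n IH] [|j] //=; rewrite IH. Qed.

Lemma psum_cons z c cs j : psum z (c :: cs) j.+1 = psum (z + c) cs j.
Proof. by rewrite /psum /= addnA. Qed.

Lemma psum_cons0 z c cs : psum z (c :: cs) 0 = z.
Proof. by rewrite /psum /= addn0. Qed.

(** The base [z.+1] records a unit inserted in front, while [row_bump] removes one from the first
    nonzero entry. Sums before that entry rise from [z] to [z.+1]; later ones are unchanged. *)
Lemma psum_bump z cs a j :
  psum z.+1 (row_bump cs a).1 j = maxn (psum z cs j) z.+1.
Proof.
elim: cs z j => [|c cs IH] z j /=; first by rewrite /psum /=; lia.
case: c => [|c] /=; case: j => [|j]; rewrite ?psum_cons0 ?psum_cons ?addn0.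
- lia.
- by rewrite IH.
- lia.
- by rewrite addSnnS /psum; lia.
Qed.

Lemma psum_ins z cs a x j : x < size cs ->
  psum z (row_ins x cs a).1 j = lis_act 0 (psum z cs) x j.
Proof.
elim: cs z x j => [//|c cs IH] z [|x] [|j] //=; rewrite /lis_act /= ltnS => xs.
- by rewrite !psum_cons addnS psum_bump {3}/psum take0 /= addn0.
- by rewrite !psum_cons IH.
Qed.

Lemma size_bump cs a : size (row_bump cs a).1 = size cs.
Proof. by elim: cs => [|[|c] cs IH] //=; rewrite IH. Qed.

Lemma size_ins x cs a : size (row_ins x cs a).1 = size cs.
Proof. by elim: cs x => [|c cs IH] [|x] //=; rewrite ?size_bump ?IH. Qed.

Lemma sumn_bump cs a : (sumn (row_bump cs a).1).+1 + a = sumn cs + (row_bump cs a).2.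
Proof. by elim: cs => [|[|c] cs IH] //=; lia. Qed.

Lemma sumn_ins x cs a : x < size cs ->
  sumn (row_ins x cs a).1 + a = sumn cs + (row_ins x cs a).2.
Proof.
elim: cs x => [|c cs IH] [|x] //= xs; last by have := IH x xs; lia.
by have := sumn_bump cs a; lia.
Qed.

(** The row total increases exactly when the counter does, and the total plus [z] is the value of
    the [lis_act] state at [d]. *)
Lemma row_run k d w z p : all (fun x => x < d) w -> size p.1 = d ->
  z + sumn p.1 + (foldl (row_step k) p w).2 =
  p.2 + foldl (lis_act k) (psum z p.1) w d.
Proof.
elim: w p => [|x w IH] p /= => [_ sp|/andP[xd wd] sp].
  by rewrite /psum take_oversize ?sp //; lia.
have -> : row_step k p x = if k <= x then row_ins x p.1 p.2 else p by [].
case: ifP => kx; last first.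
  rewrite IH //; congr (_ + _); apply: run_eq => [|j]; first exact: lis_le.
  by rewrite /lis_act kx.
have xp : x < size p.1 by rewrite sp.
have := IH (row_ins x p.1 p.2) wd; rewrite size_ins sp => /(_ erefl).
have -> : foldl (lis_act k) (psum z (row_ins x p.1 p.2).1) w d =
  foldl (lis_act k) (lis_act k (psum z p.1) x) w d.
  apply: run_eq => [|j]; first exact: lis_le.
  by rewrite psum_ins // /lis_act kx.
by have := sumn_ins p.2 xp; lia.
Qed.

Lemma row_run_bump k d w cs a : all (fun x => x < d) w -> size cs = d ->
  (foldl (row_step k) (cs, a) w).2 <= (foldl (row_step k) (row_bump cs a) w).2.
Proof.
move=> wd sc.
have := row_run k 0 wd (sc : size (cs, a).1 = d).
have sb : size (row_bump cs a).1 = d by rewrite size_bump.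
(* The base 1 stands for the sink letter that caused the bump; it makes the bumped start dominate
   the original one. *)
have := row_run k 1 wd sb => /=.
have := sumn_bump cs a.
have : foldl (lis_act k) (psum 0 cs) w d <= foldl (lis_act k) (psum 1 (row_bump cs a).1) w d.
  by apply: run_le => [|j]; [exact: lis_le|rewrite psum_bump leq_maxl].
by lia.
Qed.

Lemma row_run_nseq k d w cs : all (fun x => x < d) w -> size cs = d ->
  (foldl (row_step k) (nseq d 0, 0) w).2 <=
  (foldl (row_step k) (cs, 0) w).2 + sumn cs.
Proof.
move=> wd sc.
have := row_run k 0 wd (sc : size (cs, 0).1 = d).
have sb : size (nseq d 0, 0).1 = d by rewrite size_nseq.
have := row_run k 0 wd sb => /=; rewrite sumn_nseq mul0n.
have : foldl (lis_act k) (psum 0 (nseq d 0)) w d <= foldl (lis_act k) (psum 0 cs) w d.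
  apply: run_le => [|j]; first exact: lis_le.
  by rewrite /psum sumn_take_nseq0.
by lia.
Qed.

Lemma shRSK_part_le_row_run d k w : all (fun x => x < d) w ->
  shRSK_part w k <= (foldl (row_step k) (nseq d 0, 0) w).2.
Proof.
move=> wd; apply: leq_trans (shRSK_part_le_lis k wd) _.
have sb : size (nseq d 0, 0).1 = d by rewrite size_nseq.
have := row_run k 0 wd sb => /=; rewrite sumn_nseq mul0n !add0n => ->.
by apply: run_le => // j; exact: lis_le.
Qed.

(** * The chain automaton as a tandem queue *)

(* A state [a :: cs] of the tandem queue: [a] departures, queue [i] of length [cs`_i]. *)
Fixpoint push (s : seq nat) : seq nat :=
  if s is c :: s' then if s' is [::] then [:: c.+1] else c :: push s' else [::].

Fixpoint serve (i : nat) (s : seq nat) : seq nat :=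
  if s is c :: s' then
    if i is i'.+1 then c :: serve i' s'
    else if s' is q.+1 :: s'' then c.+1 :: q :: s'' else s
  else [::].

Definition tandem_step (k : nat) (s : seq nat) (x : nat) :=
  if x == k then push s else if x < k then serve x s else s.

Lemma psum_serve z s i j : i.+1 < size s ->
  psum z (serve i s) j.+1 = if j == i
    then minn (psum z s j.+1).+1 (psum z s j.+2) else psum z s j.+1.
Proof.
elim: s z i j => [//|c s IH] z [|i] j /=; rewrite ltnS => js.
  case: s js {IH} => [|[|q] s] // _; case: j => [|j];
    rewrite /psum /= ?take0 /=; lia.
rewrite !psum_cons; case: j => [|j]; first by rewrite /psum !take0.
by rewrite IH.
Qed.

Lemma psum_push z s j : psum z (push s) j =
  if (0 < size s) && (size s <= j) then (psum z s j).+1 else psum z s j.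
Proof.
elim: s z j => [//|c [|c' s] IH] z [|j] //.
  by rewrite /psum /=; lia.
by rewrite [push _]/= !psum_cons IH.
Qed.

Lemma size_push s : size (push s) = size s.
Proof. by elim: s => [|c [|c' s] IH] //; exact: (congr1 S IH). Qed.

Lemma size_serve i s : size (serve i s) = size s.
Proof.
by elim: s i => [|c s IH] [|i] //=; [case: s {IH} => [|[|q] s]|rewrite IH].
Qed.

(** Departures plus the customers in queues below [j] count the customers already served at queue
    [j], that is, the chains that have reached letter [j]; hence the shift to [j.+1]. *)
Lemma tandem_run k w s : size s = k.+1 ->
  head 0 (foldl (tandem_step k) s w) =
  foldl (chain_act k) (fun j => psum 0 s j.+1) w 0.
Proof.
elim: w s => [|x w IH] s sk /=.
  by case: s sk => //= c s _; rewrite /psum /= take0 /=; lia.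
rewrite IH; last by rewrite /tandem_step; do ![case: ifP => _]; rewrite ?size_push ?size_serve.
apply: run_eq => [|j]; first exact: chain_le.
rewrite /tandem_step /chain_act; case: eqVneq => xk; first by rewrite psum_push sk.
by case: ltnP => //= xk'; rewrite psum_serve ?sk.
Qed.

Lemma tandem_run_push k w s : size s = k.+1 ->
  head 0 (foldl (tandem_step k) s w) <= head 0 (foldl (tandem_step k) (push s) w).
Proof.
move=> sk; rewrite !tandem_run ?size_push //; apply: run_le => [|j].
  exact: chain_le.
by rewrite psum_push; case: ifP.
Qed.

Lemma tandem_run_nseq k w cs : size cs = k ->
  head 0 (foldl (tandem_step k) (0 :: cs) w) <=
  head 0 (foldl (tandem_step k) (0 :: nseq k 0) w) + sumn cs.
Proof.
move=> sk; rewrite !tandem_run /= ?size_nseq ?sk // addnC.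
rewrite -(run_add (@chain_le k) (@chain_add k)).
apply: run_le => [|j]; first exact: chain_le.
rewrite /psum /= sumn_take_nseq0.
by rewrite -{2}(cat_take_drop j cs) sumn_cat; lia.
Qed.

Lemma tandem_run_le_shRSK_part k w :
  head 0 (foldl (tandem_step k) (0 :: nseq k 0) w) <= shRSK_part w k.
Proof.
apply: leq_trans (chain_le_shRSK_part k w); rewrite tandem_run /= ?size_nseq //.
apply: run_le => [|j]; first exact: chain_le.
by rewrite /psum /= sumn_take_nseq0.
Qed.

(** * Truncated geometric laws *)

Definition trunc (m : nat) (cs : seq nat) : seq nat := [seq minn c m | c <- cs].

Lemma trunc_trunc m M cs : m <= M -> trunc m (trunc M cs) = trunc m cs.
Proof.
by move=> mM; rewrite /trunc -map_comp; apply: eq_map => c /=; lia.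
Qed.

Lemma trunc_bump m cs a :
  (trunc m (row_bump (trunc m.+1 cs) a).1, (row_bump (trunc m.+1 cs) a).2) =
  (trunc m (row_bump cs a).1, (row_bump cs a).2).
Proof.
elim: cs => [//|[|c] cs [IH1 IH2]] /=; first by rewrite IH1 IH2.
by rewrite -/(trunc _ _) minnSS /= trunc_trunc //; congr (_ :: _, _); lia.
Qed.

Lemma trunc_ins m x cs a :
  (trunc m (row_ins x (trunc m.+1 cs) a).1, (row_ins x (trunc m.+1 cs) a).2) =
  (trunc m (row_ins x cs a).1, (row_ins x cs a).2).
Proof.
elim: cs x => [//|c cs IH] [|x] /=.
  have [-> ->] := trunc_bump m cs a; congr (_ :: _, _); lia.
have [-> ->] := IH x; congr (_ :: _, _); lia.
Qed.

(** A step only tests multiplicities for zero and changes each by at most one, so every letter read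
    costs one level of truncation. *)
Lemma row_run_trunc k m w cs a : size w <= m ->
  (foldl (row_step k) (trunc m cs, a) w).2 = (foldl (row_step k) (cs, a) w).2.
Proof.
elim: w m cs a => [//|x w IH] [//|m] cs a /= wm.
have E p : foldl (row_step k) p w = foldl (row_step k) (p.1, p.2) w by case: p.
rewrite (E (row_step k (trunc _ _, _) x)) (E (row_step k (cs, _) x)).
rewrite -(IH m) // -[in RHS](IH m) // /row_step /=.
case: ifP => _ /=; last by rewrite trunc_trunc.
by have [-> ->] := trunc_ins m x cs a.
Qed.

Lemma row_run_shift k d w cs a : all (fun x => x < d) w -> size cs = d ->
  (foldl (row_step k) (cs, a.+1) w).2 = (foldl (row_step k) (cs, a) w).2.+1.
Proof.
move=> wd sc.
have := row_run k 0 wd (sc : size (cs, a).1 = d).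
have := row_run k 0 wd (sc : size (cs, a.+1).1 = d) => /=; lia.
Qed.

Lemma trunc_serve m i s : trunc m (serve i (trunc m.+1 s)) = trunc m (serve i s).
Proof.
elim: s i => [//|c s IH] [|i] /=; last by rewrite -/(trunc _ _) IH; congr cons; lia.
case: s {IH} => [|[|q] s] /=; rewrite -?/(trunc _ _) ?minnSS /= -/(trunc _ _) ?trunc_trunc //;
  by do ?[congr cons]; lia.
Qed.

Lemma trunc_push m s : trunc m (push (trunc m.+1 s)) = trunc m (push s).
Proof.
elim: s => [//|c [|c' s] IH]; first by congr cons; lia.
by rewrite -[LHS]/(minn (minn c m.+1) m :: trunc m (push (trunc m.+1 (c' :: s)))) IH
  -[RHS]/(minn c m :: trunc m (push (c' :: s))); congr cons; lia.
Qed.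

(** The departure counter is the observed quantity and stays exact; only the queues are
    truncated. *)
Definition trunc_tail m (s : seq nat) := if s is a :: cs then a :: trunc m cs else [::].

Lemma trunc_tail_step k m x s :
  trunc_tail m (tandem_step k (trunc_tail m.+1 s) x) = trunc_tail m (tandem_step k s x).
Proof.
rewrite /tandem_step; case: ifP => _.
  case: s => [//|a [//|c s]].
  by congr cons; exact: (trunc_push m (c :: s)).
case: ifP => _; last by case: s => //= a s; rewrite trunc_trunc.
case: s x => [//|a s] [|x] /=; last by rewrite trunc_serve.
case: s => [//|[|q] s] /=; rewrite -?/(trunc _ _) ?minnSS /= -?/(trunc _ _) ?trunc_trunc //.
by do ?[congr cons]; lia.
Qed.

Lemma tandem_run_trunc k m w s : size w <= m ->
  head 0 (foldl (tandem_step k) (trunc_tail m s) w) = head 0 (foldl (tandem_step k) s w).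
Proof.
elim: w m s => [|x w IH] [|m] s //= wm; try by case: s.
by rewrite -(IH m) // trunc_tail_step (IH m).
Qed.

Lemma tandem_run_shift k w cs a : size cs = k ->
  head 0 (foldl (tandem_step k) (a.+1 :: cs) w) =
  (head 0 (foldl (tandem_step k) (a :: cs) w)).+1.
Proof.
move=> sc; rewrite !tandem_run /= ?sc //.
have := run_add (@chain_le k) (@chain_add k) 1 w (fun j => psum 0 (a :: cs) j.+1) 0.
rewrite add1n => <-.
by apply: run_eq => [|j]; first exact: chain_le.
Qed.

Local Open Scope ring_scope.

Section Geometric.
Variable R : realFieldType.

(* The expectation of [f (min X M)] for [X] geometric with ratio [r]: truncating
   keeps everything finite, since an [rcfType] may be non-archimedean. *)
Fixpoint geo (r : R) (M : nat) (f : nat -> R) : R :=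
  if M is M'.+1 then (1 - r) * f 0%N + r * geo r M' (fun c => f c.+1) else f 0%N.

Lemma geo_eq r M f g : f =1 g -> geo r M f = geo r M g.
Proof. by elim: M f g => [|M IH] f g fg /=; rewrite fg // (IH _ (g \o S)) // => c /=. Qed.

Lemma geoD r M f g : geo r M (fun c => f c + g c) = geo r M f + geo r M g.
Proof. by elim: M f g => [|M IH] f g //=; rewrite IH; ring. Qed.

Lemma geoZ r M a f : geo r M (fun c => a * f c) = a * geo r M f.
Proof. by elim: M f => [|M IH] f //=; rewrite IH; ring. Qed.

Lemma geo_const r M a : geo r M (fun=> a) = a.
Proof. by elim: M => [|M IH] //=; rewrite IH; ring. Qed.

Lemma geo_le r M f g : 0 <= r <= 1 -> (forall c, f c <= g c) ->
  geo r M f <= geo r M g.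
Proof.
move=> /andP[r0 r1]; elim: M f g => [|M IH] f g fg //=.
by apply: lerD; apply: ler_wpM2l => //; [lra|exact: IH].
Qed.

Lemma geo_mean_le r M : 0 <= r < 1 -> geo r M (fun c => c%:R) <= r / (1 - r).
Proof.
move=> /andP[r0 r1]; have r1' : 0 < 1 - r by lra.
elim: M => [|M IH] /=; first by rewrite divr_ge0 // ltW.
rewrite mulr0 add0r (@geo_eq _ _ _ (fun c => c%:R + 1)); last first.
  by move=> c; rewrite -natr1.
rewrite geoD geo_const.
have -> : r / (1 - r) = r * (r / (1 - r) + 1) by field; lra.
by apply: ler_wpM2l => //; lra.
Qed.

Lemma geo_stable r M f : (forall c, f (minn c M) = f c) ->
  geo r M.+1 f = geo r M f.
Proof.
elim: M f => [|M IH] f fs /=; first by rewrite -(fs 1%N) /=; ring.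
congr (_ + _ * _); apply: IH => c; by rewrite -(fs c.+1) minnSS.
Qed.

(** Memorylessness: conditioned on being positive, a geometric variable is one plus a copy of
    itself. It is exact under truncation once [f] is constant from [M] on. *)
Lemma geo_succ r M f : (forall c, f (minn c M) = f c) ->
  r * geo r M.+1 (fun c => f c.+1) = geo r M.+1 f - (1 - r) * f 0%N.
Proof.
move=> fs; rewrite geo_stable; first by rewrite /=; ring.
by move=> c; rewrite -fs -[RHS]fs; congr f; lia.
Qed.

Lemma geo_pred r M f g : (forall c, f (minn c M) = f c) ->
  geo r M.+1 (fun c => if c is c'.+1 then f c' else g) =
  (1 - r) * g + r * geo r M.+1 f.
Proof. by move=> fs; rewrite [in RHS]geo_stable. Qed.

Arguments geo : simpl never.

Fixpoint pgeo (rs : seq R) (M : nat) (F : seq nat -> R) : R :=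
  if rs is r :: rs' then geo r M (fun c => pgeo rs' M (fun cs => F (c :: cs)))
  else F [::].

Lemma pgeo_eq rs M F G : F =1 G -> pgeo rs M F = pgeo rs M G.
Proof.
by elim: rs F G => [|r rs IH] F G FG //=; apply: geo_eq => c; apply: IH => cs.
Qed.

Lemma pgeo_eq_size rs M F G : (forall cs, size cs = size rs -> F cs = G cs) ->
  pgeo rs M F = pgeo rs M G.
Proof.
elim: rs F G => [|r rs IH] F G FG /=; first exact: FG.
by apply: geo_eq => c; apply: IH => cs sc; apply: FG; rewrite /= sc.
Qed.

Lemma pgeoD rs M F G :
  pgeo rs M (fun c => F c + G c) = pgeo rs M F + pgeo rs M G.
Proof.
elim: rs F G => [|r rs IH] F G //=; rewrite -geoD.
by apply: geo_eq => c; rewrite IH.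
Qed.

Lemma pgeoZ rs M a F : pgeo rs M (fun c => a * F c) = a * pgeo rs M F.
Proof.
elim: rs F => [|r rs IH] F //=; rewrite -geoZ.
by apply: geo_eq => c; rewrite IH.
Qed.

Lemma pgeo_const rs M a : pgeo rs M (fun=> a) = a.
Proof.
elim: rs => [|r rs IH] //=; rewrite -[RHS](geo_const r M).
by apply: geo_eq => c; rewrite IH.
Qed.

Lemma pgeo_sum rs M (I : Type) (s : seq I) (P : pred I) (a : I -> R) F :
  pgeo rs M (fun c => \sum_(i <- s | P i) a i * F i c) =
  \sum_(i <- s | P i) a i * pgeo rs M (F i).
Proof.
elim: s => [|i s IH].
  rewrite big_nil -[RHS](pgeo_const rs M); apply: pgeo_eq => c; exact: big_nil.
rewrite big_cons -IH; case: ifP => Pi.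
  by rewrite -pgeoZ -pgeoD; apply: pgeo_eq => c; rewrite big_cons Pi.
by apply: pgeo_eq => c; rewrite big_cons Pi.
Qed.

Lemma pgeo_le rs M F G : all (fun r => 0 <= r <= 1) rs ->
  (forall cs, size cs = size rs -> F cs <= G cs) -> pgeo rs M F <= pgeo rs M G.
Proof.
elim: rs F G => [|r rs IH] F G /=; first by move=> _; apply.
case/andP=> r01 rs01 FG; apply: geo_le => // c; apply: IH => // cs sc.
by apply: FG; rewrite /= sc.
Qed.

Lemma pgeo_sumn_le rs M : all (fun r => 0 <= r < 1) rs ->
  pgeo rs M (fun cs => (sumn cs)%:R) <= \sum_(r <- rs) r / (1 - r).
Proof.
elim: rs => [|r rs IH] /=; first by rewrite big_nil.
case/andP=> r01 rs01; rewrite big_cons.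
rewrite (@geo_eq _ _ _ (fun c => c%:R + pgeo rs M (fun cs => (sumn cs)%:R))).
  by rewrite geoD geo_const lerD ?geo_mean_le ?IH.
move=> c; rewrite -[in RHS](pgeo_const rs M c%:R) -pgeoD.
by apply: pgeo_eq => cs; rewrite natrD.
Qed.

(* Invariance of the product geometric law for row insertion with letters of
   rates [rs] and a sink letter of rate 1 below them, acting as [row_bump]. *)
Lemma row_stationary rs M a (F : seq nat * nat -> R) :
  (forall cs b, F (trunc M cs, b) = F (cs, b)) ->
  \sum_(i < size rs) rs`_i * pgeo rs M.+1 (fun cs => F (row_ins i cs a)) +
    pgeo rs M.+1 (fun cs => F (row_bump cs a)) =
  pgeo rs M.+1 (fun cs => F (cs, a.+1)) +
    (\sum_(i < size rs) rs`_i) * pgeo rs M.+1 (fun cs => F (cs, a)).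
Proof.
elim: rs F => [|r rs IH] F Fs; first by rewrite !big_ord0 /= mul0r add0r addr0.
have Fc c cs b : F (minn c M :: cs, b) = F (c :: cs, b).
  by rewrite -Fs -[RHS]Fs /=; congr (F (_ :: _, _)); lia.
pose N c := pgeo rs M.+1 (fun cs => F (c :: cs, a)).
pose P c := pgeo rs M.+1 (fun cs => F (c :: cs, a.+1)).
pose B c := pgeo rs M.+1 (fun cs => F (c :: (row_bump cs a).1, (row_bump cs a).2)).
pose I i c := pgeo rs M.+1 (fun cs => F (c :: (row_ins i cs a).1, (row_ins i cs a).2)).
(* For fixed multiplicity [c] of the first letter, the rest of the row again sees a sink: it is
   bumped by each insertion of that letter, and by the original sink when [c = 0]. By [geo_succ] the
   two contributions add up to rate one, the terms in [B 0%N] cancelling. *)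
have IHc c : \sum_(i < size rs) rs`_i * I i c + B c =
    P c + (\sum_(i < size rs) rs`_i) * N c.
  apply: (IH (fun p => F (c :: p.1, p.2))) => cs b /=.
  by rewrite -Fs -[RHS]Fs /= -/(trunc _ _) trunc_trunc.
have Bs c : B (minn c M) = B c by apply: pgeo_eq => cs; rewrite Fc.
have Ns c : N (minn c M) = N c by apply: pgeo_eq => cs; rewrite Fc.
have E : pgeo (r :: rs) M.+1 (fun cs => F (row_bump cs a)) =
    (1 - r) * B 0%N + r * geo r M.+1 N.
  by rewrite -geo_pred //; apply: geo_eq => -[|c].
rewrite {}E [size _]/= !big_ord_recl [LHS]/= [RHS]/=.
rewrite -/(geo r M.+1 P) -/(geo r M.+1 N) -/(geo r M.+1 (fun c => B c.+1)).
have Bsucc := geo_succ r Bs.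
have {}IHc := geo_eq r M.+1 IHc.
rewrite !geoD geoZ in IHc.
have EI : geo r M.+1 (fun c => \sum_(i < size rs) rs`_i * I i c) =
    \sum_(i < size rs) rs`_i * geo r M.+1 (I i).
  exact: (@pgeo_sum [:: r] M.+1 _ _ _ (fun i : 'I_(size rs) => rs`_i) (fun i cs => I i (head 0%N cs))).
rewrite {}EI in IHc.
change (r * geo r M.+1 (fun c => B c.+1) +
    \sum_(i < size rs) rs`_i * geo r M.+1 (I i) +
    ((1 - r) * B 0%N + r * geo r M.+1 N) =
  geo r M.+1 P + (r + \sum_(i < size rs) rs`_i) * geo r M.+1 N).
by rewrite Bsucc; lra.
Qed.

(* Burke-type invariance for the tandem queue: customers arrive at rate [b] and
   server [i] has rate [al`_i], so that the load of queue [i] is [b / al`_i]. *)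
Lemma tandem_stationary al b M a (F : seq nat -> R) :
  all (fun x => x != 0) al ->
  (forall cs a, F (a :: trunc M cs) = F (a :: cs)) ->
  let rs := [seq b / x | x <- al] in
  \sum_(i < size al) al`_i * pgeo rs M.+1 (fun cs => F (serve i (a :: cs))) +
    b * pgeo rs M.+1 (fun cs => F (push (a :: cs))) =
  b * pgeo rs M.+1 (fun cs => F (a.+1 :: cs)) +
    (\sum_(i < size al) al`_i) * pgeo rs M.+1 (fun cs => F (a :: cs)).
Proof.
elim: al a F => [|x al IH] a F /=; first by rewrite !big_ord0 mul0r add0r addr0.
case/andP=> x0 al0 Fs.
set r := b / x; set rs := [seq b / x | x <- al] in IH *.
have Fc c cs d : F (d :: minn c M :: cs) = F (d :: c :: cs).
  by rewrite -Fs -[RHS]Fs /=; congr (F (_ :: _ :: _)); lia.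
pose N c := pgeo rs M.+1 (fun cs => F (a :: c :: cs)).
pose P c := pgeo rs M.+1 (fun cs => F (a.+1 :: c :: cs)).
pose Q c := pgeo rs M.+1 (fun cs => F (a :: push (c :: cs))).
pose I i c := pgeo rs M.+1 (fun cs => F (a :: serve i (c :: cs))).
(* The departure counter of the shorter line is the content [c] of the first queue here, so the
   upstream output feeds that queue at rate [b]. *)
have IHc c : \sum_(i < size al) al`_i * I i c + b * Q c =
    b * N c.+1 + (\sum_(i < size al) al`_i) * N c.
  apply: (IH c (fun s => F (a :: s)) al0) => cs d.
  by rewrite -Fs -[RHS]Fs /= -/(trunc _ _) trunc_trunc.
have Ns c : N (minn c M) = N c by apply: pgeo_eq => cs; rewrite Fc.
have Ps c : P (minn c M) = P c by apply: pgeo_eq => cs; rewrite Fc.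
have E : geo r M.+1 (fun c => pgeo rs M.+1 (fun cs => F (serve 0 [:: a, c & cs]))) =
    (1 - r) * N 0%N + r * geo r M.+1 P.
  by rewrite -geo_pred //; apply: geo_eq => -[|c].
rewrite !big_ord_recl {}E.
have Nsucc := geo_succ r Ns.
have {}IHc := geo_eq r M.+1 IHc.
rewrite !geoD !geoZ in IHc.
have EI : geo r M.+1 (fun c => \sum_(i < size al) al`_i * I i c) =
    \sum_(i < size al) al`_i * geo r M.+1 (I i).
  exact: (@pgeo_sum [:: r] M.+1 _ _ _ (fun i : 'I_(size al) => al`_i) (fun i cs => I i (head 0%N cs))).
rewrite {}EI in IHc.
change (x * ((1 - r) * N 0%N + r * geo r M.+1 P) +
    \sum_(i < size al) al`_i * geo r M.+1 (I i) + b * geo r M.+1 Q =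
  b * geo r M.+1 P + (x + \sum_(i < size al) al`_i) * geo r M.+1 N).
(* The load is chosen so that the flow [x * r] out of the first queue equals the flow [b] into it.
   The service wasted on an empty queue cancels the boundary term of the arrivals. *)
have bE : b = x * r by rewrite /r; field.
have E : b * geo r M.+1 (fun c => N c.+1) = x * geo r M.+1 N - x * (1 - r) * N 0%N.
  by rewrite bE -mulrA Nsucc; ring.
have E' : x * (r * geo r M.+1 P) = b * geo r M.+1 P by rewrite bE; ring.
by rewrite mulrDr E'; lra.
Qed.

End Geometric.

(** * Expectations over random words *)

Section WordExpectation.
Variables (R : realFieldType) (d : nat) (alpha : 'I_d -> R).
Hypothesis alpha_ge0 : forall i, 0 <= alpha i.
Hypothesis alpha_sum : \sum_(i < d) alpha i = 1.

Definition word_exp (n : nat) (f : seq nat -> R) : R :=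
  \sum_(w : n.-tuple 'I_d) word_prob alpha w * f (word_nat w).

Lemma word_exp0 f : word_exp 0 f = f [::].
Proof.
rewrite /word_exp (big_pred1 [tuple]) => [|w]; last by apply/esym/eqP; exact: tuple0.
by rewrite /word_prob big_ord0 mul1r.
Qed.

Lemma word_expS n f : word_exp n.+1 f =
  \sum_(x < d) alpha x * word_exp n (fun w => f (val x :: w)).
Proof.
rewrite /word_exp.
under [RHS]eq_bigr do rewrite mulr_sumr.
rewrite pair_big /=.
rewrite (reindex (fun p : 'I_d * n.-tuple 'I_d => [tuple of p.1 :: p.2])) /=.
  apply: eq_bigr => -[x w] _ /=; rewrite mulrA; congr (_ * _).
  rewrite /word_prob big_ord_recl tnth0; congr (_ * _).
  by apply: eq_bigr => i _; rewrite tnthS.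
exists (fun w : n.+1.-tuple 'I_d => (thead w, [tuple of behead w])) => [[x w]|w] _ /=.
  rewrite theadE; congr (_, _); exact: val_inj.
by rewrite -tuple_eta.
Qed.

Lemma word_exp_eq n f g :
  (forall w, size w = n -> all (fun x => x < d)%N w -> f w = g w) ->
  word_exp n f = word_exp n g.
Proof.
move=> fg; apply: eq_bigr => w _; rewrite fg ?size_map ?size_tuple //.
by apply/allP => x /mapP[i _ ->]; exact: ltn_ord.
Qed.

Lemma word_exp_le n f g :
  (forall w, size w = n -> all (fun x => x < d)%N w -> f w <= g w) ->
  word_exp n f <= word_exp n g.
Proof.
move=> fg; apply: ler_sum => w _; apply: ler_wpM2l; first exact: prodr_ge0.
by apply: fg; rewrite ?size_map ?size_tuple //; apply/allP => x /mapP[i _ ->]; exact: ltn_ord.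
Qed.

Lemma word_exp_const n a : word_exp n (fun=> a) = a.
Proof.
elim: n => [|n IH]; first exact: word_exp0.
by rewrite word_expS; under eq_bigr do rewrite IH; rewrite -mulr_suml alpha_sum mul1r.
Qed.

Lemma word_expD n f g :
  word_exp n (fun w => f w + g w) = word_exp n f + word_exp n g.
Proof. by rewrite -big_split; apply: eq_bigr => w _; rewrite mulrDr. Qed.

End WordExpectation.

(** * Bounds on the expected row length with a free rate *)

Section RowBounds.
Variables (R : realFieldType) (d : nat) (alpha : 'I_d -> R).
Hypothesis alpha_ge0 : forall i, 0 <= alpha i.
Hypothesis alpha_sum : \sum_(i < d) alpha i = 1.

Definition letter_prob (i : nat) : R := oapp alpha 0 (insub i).

Lemma letter_probE (i : 'I_d) : letter_prob i = alpha i.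
Proof. by rewrite /letter_prob valK. Qed.

Lemma SW_exp_partE n k :
  SW_exp_part n alpha k = word_exp alpha n (fun w => (shRSK_part w k)%:R).
Proof. by []. Qed.

Lemma SW_exp_part_le n (k : 'I_d) theta : 0 < theta ->
  (forall j : 'I_d, (k <= j)%N -> alpha j < theta) ->
  SW_exp_part n alpha k <=
  theta * n%:R + \sum_(j < d | (k <= j)%N) alpha j / (theta - alpha j).
Proof.
move=> t0 at_lt.
(* Letters below [k] do not act, and get ratio 0. Dividing by [theta] normalizes the sink to rate
   one, as in [row_stationary]. *)
pose rho (i : nat) : R := if (k <= i)%N then letter_prob i / theta else 0.
pose rs := mkseq rho d.
have size_rs : size rs = d by rewrite size_mkseq.
have rho01 i : 0 <= rho i < 1.
  rewrite /rho /letter_prob; case: ifP => [ki|_]; last by rewrite lexx ltr01.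
  case: insubP => [j _ ji|_] /=; last by rewrite mul0r lexx ltr01.
  by rewrite divr_ge0 ?(ltW t0) // ltr_pdivrMr // mul1r at_lt // ji.
have rs01 : all (fun r => 0 <= r < 1) rs.
  by apply/allP => r /mapP[i _ ->].
have rs01' : all (fun r => 0 <= r <= 1) rs.
  by apply: sub_all rs01 => r /andP[-> /ltW].
pose V m p := word_exp alpha m (fun w => (foldl (row_step k) p w).2%:R).
(* Words of length [m <= n] do not distinguish multiplicities above [n], so [row_stationary] applies
   with [M = n]. *)
pose W m a := pgeo rs n.+1 (fun cs => V m (cs, a)).
have V_shift m cs a : size cs = d -> V m (cs, a.+1) = V m (cs, a) + 1.
  move=> sc; rewrite -[X in _ + X](word_exp_const alpha_sum m) -word_expD.
  apply: word_exp_eq => w _ wd.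
  by rewrite (row_run_shift _ _ wd sc) -natr1.
have V_trunc m cs a : (m <= n)%N -> V m (trunc n cs, a) = V m (cs, a).
  by move=> mn; apply: word_exp_eq => w sw _; rewrite row_run_trunc ?sw.
have W_shift m a : W m a.+1 = W m a + 1.
  rewrite -[X in _ + X](pgeo_const rs n.+1) -pgeoD.
  by apply: pgeo_eq_size => cs sc; rewrite V_shift // sc.
have W_le m a : (m <= n)%N -> W m a <= a%:R + theta * m%:R.
  elim: m => [|m IH] mn.
    rewrite mulr0 addr0 -[X in _ <= X](pgeo_const rs n.+1) /W.
    by rewrite (@pgeo_eq _ _ _ _ (fun=> a%:R)) // => cs; rewrite /V word_exp0.
  have stat := row_stationary rs a (fun cs b => V_trunc m cs b (ltnW mn)).
  rewrite !size_rs in stat.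
  have -> : W m.+1 a = \sum_(x < d) alpha x * pgeo rs n.+1 (fun cs => V m (row_step k (cs, a) x)).
    rewrite -pgeo_sum; apply: pgeo_eq => cs; exact: word_expS.
  have -> : \sum_(x < d) alpha x * pgeo rs n.+1 (fun cs => V m (row_step k (cs, a) x)) =
    \sum_(x < d) (theta * (rs`_x * pgeo rs n.+1 (fun cs => V m (row_ins x cs a)))
       + (alpha x * W m a - theta * (rs`_x * W m a))).
    apply: eq_bigr => x _; rewrite nth_mkseq // /rho letter_probE /row_step.
    by case: ifP => kx; [field; rewrite gt_eqF|rewrite -/(W m a); ring].
  rewrite big_split /= -mulr_sumr sumrB -!mulr_suml -mulr_sumr -mulr_suml alpha_sum mul1r.
  (* The sink does not occur in the word. Since a bump never lowers the final count, dropping it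
     from the balance leaves a growth of at most [theta] per letter. *)
  have bump_ge : W m a <= pgeo rs n.+1 (fun cs => V m (row_bump cs a)).
    apply: pgeo_le => // cs sc; apply: word_exp_le => // w _ wd.
    by rewrite ler_nat (row_run_bump _ _ wd) // sc.
  have /(ler_wpM2l (ltW t0)) := bump_ge.
  move: stat; rewrite -/(W m a.+1) -/(W m a) W_shift => stat.
  have /(congr1 ( *%R theta)) := stat.
  have := IH (ltnW mn); rewrite -(natr1 m); rewrite !mulrDr.
  by lra.
(* Starting empty instead of stationary gains at most the initial row length, whose mean gives the
   sum in the bound. *)
have start : SW_exp_part n alpha k <= W n 0%N + pgeo rs n.+1 (fun cs => (sumn cs)%:R).
  rewrite -pgeoD -[X in X <= _](pgeo_const rs n.+1).
  apply: pgeo_le => // cs; rewrite size_rs => sc.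
  rewrite -[X in _ + X](word_exp_const alpha_sum n) -word_expD SW_exp_partE.
  apply: word_exp_le => // w _ wd; rewrite -natrD ler_nat.
  exact: leq_trans (shRSK_part_le_row_run _ wd) (row_run_nseq _ wd sc).
apply: (le_trans start); apply: lerD; first by rewrite -[X in _ <= X]add0r W_le.
apply: (le_trans (pgeo_sumn_le _ rs01)).
rewrite big_map -[X in iota 0 X]subn0 -/(index_iota 0 d) big_mkord [X in _ <= X]big_mkcond.
apply: ler_sum => j _; rewrite /rho letter_probE; case: ifP => kj; last by rewrite mul0r.
have := at_lt j kj => ajt.
by rewrite le_eqVlt; apply/orP; left; apply/eqP; field; rewrite !gt_eqF //; lra.
Qed.

Lemma SW_exp_part_ge n (k : 'I_d) b : 0 <= b -> b <= alpha k ->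
  (forall j : 'I_d, (j < k)%N -> b < alpha j) ->
  b * n%:R - \sum_(j < d | (j < k)%N) b / (alpha j - b) <= SW_exp_part n alpha k.
Proof.
move=> b0 bk b_lt.
pose al := mkseq letter_prob k.
pose rs := [seq b / x | x <- al].
have size_al : size al = k by rewrite size_mkseq.
have size_rs : size rs = k by rewrite size_map.
have al_gt x : x \in al -> b < x.
  move=> /mapP[i]; rewrite mem_iota add0n => /= ik ->.
  have id : (i < d)%N by exact: ltn_trans ik (ltn_ord k).
  by rewrite (letter_probE (Ordinal id)) b_lt.
have al0 : all (fun x => x != 0) al.
  by apply/allP => x /al_gt bx; rewrite gt_eqF //; lra.
have rs01 : all (fun r => 0 <= r < 1) rs.
  apply/allP => r /mapP[x /al_gt bx ->]; have x0 : 0 < x by lra.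
  by rewrite divr_ge0 ?(ltW x0) //= ltr_pdivrMr // mul1r.
have rs01' : all (fun r => 0 <= r <= 1) rs.
  by apply: sub_all rs01 => r /andP[-> /ltW].
pose V m s := word_exp alpha m (fun w => (head 0%N (foldl (tandem_step k) s w))%:R : R).
pose U m a := pgeo rs n.+1 (fun cs => V m (a :: cs)).
have V_shift m cs a : size cs = k -> V m (a.+1 :: cs) = V m (a :: cs) + 1.
  move=> sc; rewrite -[X in _ + X](word_exp_const alpha_sum m) -word_expD.
  by apply: word_exp_eq => w _ wd; rewrite tandem_run_shift // -natr1.
have V_trunc m cs a : (m <= n)%N -> V m (a :: trunc n cs) = V m (a :: cs).
  move=> mn; apply: word_exp_eq => w sw _.
  by rewrite -[a :: trunc n cs]/(trunc_tail n (a :: cs)) tandem_run_trunc ?sw.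
have U_shift m a : U m a.+1 = U m a + 1.
  rewrite -[X in _ + X](pgeo_const rs n.+1) -pgeoD.
  by apply: pgeo_eq_size => cs sc; rewrite V_shift // sc.
have sum_lt (H : nat -> R) : \sum_(x < d | (x < k)%N) alpha x * H x =
    \sum_(i < size al) al`_i * H i.
  rewrite size_al (big_ord_widen_cond _ (fun=> true) (fun i => al`_i * H i) (ltnW (ltn_ord k))).
  by apply: eq_big => // x /= xk; rewrite nth_mkseq // letter_probE.
have U_ge m a : (m <= n)%N -> a%:R + b * m%:R <= U m a.
  elim: m => [|m IH] mn.
    rewrite mulr0 addr0 -[X in X <= _](pgeo_const rs n.+1) /U.
    by rewrite (@pgeo_eq _ _ _ (fun cs => V 0%N (a :: cs)) (fun=> a%:R)) // => cs; rewrite /V word_exp0.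
  have stat := tandem_stationary b a al0 (fun cs c => V_trunc m cs c (ltnW mn)).
  rewrite /= -/rs -(sum_lt (fun i => pgeo rs n.+1 (fun cs => V m (serve i (a :: cs))))) in stat.
  have sum1 := sum_lt (fun=> 1).
  rewrite -!mulr_suml !mulr1 in sum1.
  rewrite -sum1 -/(U m a) -/(U m a.+1) U_shift in stat.
  have -> : U m.+1 a = \sum_(x < d) alpha x * pgeo rs n.+1 (fun cs => V m (tandem_step k (a :: cs) x)).
    rewrite -pgeo_sum; apply: pgeo_eq => cs; exact: word_expS.
  (* Letter [k] arrives at rate [alpha k], not [b]; the surplus arrivals cannot lower the number of
     departures. *)
  have push_ge : U m a <= pgeo rs n.+1 (fun cs => V m (push (a :: cs))).
    apply: pgeo_le => // cs sc; apply: word_exp_le => // w _ wd.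
    by rewrite ler_nat tandem_run_push //= sc size_rs.
  have := alpha_sum.
  (* The letters split into services [x < k], the arrival [k], and larger letters that leave the
     queues unchanged. *)
  rewrite !(bigID (fun x : 'I_d => (x < k)%N) predT) /=.
  rewrite !(bigD1 (P := fun x : 'I_d => ~~ (x < k)%N) k) ?ltnn //=.
  rewrite [X in _ <= X + _](eq_bigr (fun x : 'I_d => alpha x * pgeo rs n.+1 (fun cs => V m (serve x (a :: cs))))); last first.
    by move=> x xk; rewrite /tandem_step ltn_eqF ?xk.
  rewrite [X in _ <= _ + (_ + X)](eq_bigr (fun x : 'I_d => alpha x * U m a)); last first.
    by move=> x /andP[/negbTE xk /negbTE xk']; rewrite /tandem_step xk; move: xk'; rewrite -val_eqE /= => ->.
  rewrite -mulr_suml /tandem_step eqxx => asum.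
  have bk' : 0 <= alpha k - b by lra.
  have /(ler_wpM2l bk') := push_ge.
  have := IH (ltnW mn); rewrite -(natr1 m).
  move: asum stat.
  set S1 := \sum_(x < d | (x < k)%N) alpha x; set S2 := \sum_(x < d | _) alpha x.
  move=> asum.
  have -> : S2 = 1 - S1 - alpha k by lra.
  by lra.
have start : U n 0%N <= SW_exp_part n alpha k + pgeo rs n.+1 (fun cs => (sumn cs)%:R).
  rewrite -[X in _ <= X + _](pgeo_const rs n.+1) -pgeoD.
  apply: pgeo_le => // cs; rewrite size_rs => sc.
  rewrite -[X in _ + X](word_exp_const alpha_sum n) SW_exp_partE -word_expD.
  apply: word_exp_le => // w _ wd; rewrite -natrD ler_nat.
  apply: leq_trans (tandem_run_nseq _ sc) _.
  by rewrite leq_add2r tandem_run_le_shRSK_part.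
have := U_ge n 0%N (leqnn n); rewrite add0r => Un.
have : pgeo rs n.+1 (fun cs => (sumn cs)%:R) <= \sum_(j < d | (j < k)%N) b / (alpha j - b).
  apply: (le_trans (pgeo_sumn_le _ rs01)).
  rewrite big_map big_map -[X in iota 0 X]subn0 -/(index_iota 0 k) big_mkord.
  rewrite (big_ord_widen_cond _ (fun=> true) (fun i => b / letter_prob i / (1 - b / letter_prob i)) (ltnW (ltn_ord k))).
  apply: ler_sum => j /= jk; rewrite letter_probE; have := b_lt j jk => bj.
  by rewrite le_eqVlt; apply/orP; left; apply/eqP; field; rewrite !gt_eqF //; lra.
by lra.
Qed.

End RowBounds.

(** * Optimization of the rates *)

Lemma le_2sqrtM (R : rcfType) (x s m : R) : 0 <= s -> 0 <= m ->
  (forall e, 0 < e -> x <= e * m + s / e) -> x <= 2 * Num.sqrt (s * m).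
Proof.
move=> s0 m0 H; have sm0 := mulr_ge0 s0 m0.
have [x0|x0] := leP x 0; first by rewrite (le_trans x0) // mulr_ge0 // sqrtr_ge0.
move: s0; rewrite le_eqVlt => /orP[/eqP s0|s0].
  (* With [s = 0], this [e] makes [e * m] smaller than [x / 2], contradicting [0 < x]. *)
  have e0 : 0 < x / (2 * (m + 1)) by rewrite divr_gt0 //; lra.
  have := H _ e0; rewrite -s0 mul0r addr0.
  have -> : x / (2 * (m + 1)) * m = x / 2 - x / (2 * (m + 1)) by field; lra.
  by lra.
move: m0; rewrite le_eqVlt => /orP[/eqP m0|m0].
  have e0 : 0 < 2 * s / x by rewrite divr_gt0 //; lra.
  have := H _ e0; rewrite -m0 mulr0 add0r.
  have -> : s / (2 * s / x) = x / 2 by field; rewrite !gt_eqF.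
  by lra.
have q0 : 0 < Num.sqrt (s * m) by rewrite sqrtr_gt0 mulr_gt0.
(* The minimizer of [e * m + s / e], at which both terms equal [Num.sqrt (s * m)]. *)
have e0 : 0 < Num.sqrt (s * m) / m by rewrite divr_gt0.
have := H _ e0.
rewrite divfK ?gt_eqF // (_ : s / _ = Num.sqrt (s * m)); first by lra.
rewrite invf_div mulrA -[X in X / _](sqr_sqrtr sm0) expr2 mulfK // gt_eqF //.
Qed.

Theorem mainTheorem1 (R : rcfType) (d n : nat) (alpha : 'I_d -> R)
  (alpha_nneg : forall i, 0 <= alpha i)
  (alpha_sum : \sum_(i < d) alpha i = 1)
  (alpha_sorted : forall i j : 'I_d, (i <= j)%N -> alpha j <= alpha i)
  (k : 'I_d) :
  let E := SW_exp_part n alpha k in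
  let nu := Num.min 1 (alpha k * d%:R) in
  [/\ alpha k * n%:R - 2 * Num.sqrt (alpha k * (k.+1)%:R * n%:R) <= E,
      E <= alpha k * n%:R + 2 * Num.sqrt ((\sum_(j < d | (k <= j)%N) alpha j) * n%:R),
      alpha k * n%:R - 2 * Num.sqrt (nu * n%:R) <= E
    & E <= alpha k * n%:R + 2 * Num.sqrt (nu * n%:R)].
Proof.
move=> E nu; set sigma := \sum_(j < d | (k <= j)%N) alpha j.
have sigma_ge0 : 0 <= sigma by exact: sumr_ge0.
have E_ge0 : 0 <= E.
  by apply: sumr_ge0 => w _; rewrite mulr_ge0 // prodr_ge0.
have n_ge0 : 0 <= n%:R :> R by exact: ler0n.
have upper : E <= alpha k * n%:R + 2 * Num.sqrt (sigma * n%:R).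
  suff : E - alpha k * n%:R <= 2 * Num.sqrt (sigma * n%:R) by lra.
  apply: le_2sqrtM => // e e0; have ak := alpha_nneg k.
  have t0 : 0 < alpha k + e by lra.
  have at_lt (j : 'I_d) : (k <= j)%N -> alpha j < alpha k + e.
    by move=> /alpha_sorted; lra.
  have := SW_exp_part_le alpha_nneg alpha_sum n t0 at_lt.
  rewrite -/E.
  (* Since [alpha j <= alpha k], every denominator is at least [e]. *)
  have : \sum_(j < d | (k <= j)%N) alpha j / (alpha k + e - alpha j) <= sigma / e.
    rewrite mulr_suml; apply: ler_sum => j kj; apply: ler_wpM2l => //.
    by have := alpha_sorted _ _ kj => ajk; rewrite lef_pV2 ?posrE //; lra.
  by lra.
have lower : alpha k * n%:R - 2 * Num.sqrt (alpha k * k.+1%:R * n%:R) <= E.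
  suff : alpha k * n%:R - E <= 2 * Num.sqrt (alpha k * k.+1%:R * n%:R) by lra.
  have s0 : 0 <= alpha k * k.+1%:R by rewrite mulr_ge0 // ler0n.
  apply: le_2sqrtM => // e e0.
  have se0 : 0 <= alpha k * k.+1%:R / e by rewrite divr_ge0 // ltW.
  (* If [e] exceeds [alpha k], the rate [alpha k - e] would be negative, but then [e * n%:R] alone
     dominates and [0 <= E] suffices. *)
  have [ek|ke] := leP e (alpha k); last first.
    by have := ler_wpM2r n_ge0 (ltW ke); lra.
  have b0 : 0 <= alpha k - e by lra.
  have bk : alpha k - e <= alpha k by lra.
  have b_lt (j : 'I_d) : (j < k)%N -> alpha k - e < alpha j.
    by move=> /ltnW /alpha_sorted; lra.
  have := SW_exp_part_ge alpha_nneg alpha_sum n b0 bk b_lt.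
  rewrite -/E.
  have : \sum_(j < d | (j < k)%N) (alpha k - e) / (alpha j - (alpha k - e)) <=
      alpha k * k.+1%:R / e.
    (* Each of the [k] terms is at most [alpha k / e]. As [k] is 0-based, the target has [k.+1] such
       terms. *)
    apply: (@le_trans _ _ (\sum_(j < d | (j < k)%N) alpha k / e)).
      apply: ler_sum => j jk; have := alpha_sorted _ _ (ltnW jk) => akj.
      apply: ler_pM => //; first by rewrite invr_ge0; lra.
      by rewrite lef_pV2 ?posrE //; lra.
    rewrite -(big_ord_widen_cond _ (fun=> true) (fun=> alpha k / e) (ltnW (ltn_ord k))).
    rewrite sumr_const card_ord -[X in X <= _]mulr_natr [X in _ <= X]mulrAC.
    by rewrite ler_wpM2l ?divr_ge0 ?(ltW e0) // ler_nat.
  by lra.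
have d_ge (m : nat) : (m <= d)%N -> alpha k * m%:R <= alpha k * d%:R.
  by move=> md; rewrite ler_wpM2l // ler_nat.
have sigma_nu : sigma <= nu.
  rewrite le_min; apply/andP; split.
    rewrite -alpha_sum [X in _ <= X](bigID (fun j : 'I_d => (k <= j)%N)) /=.
    by rewrite lerDl sumr_ge0.
  apply: (@le_trans _ _ (\sum_(j < d) alpha k)).
    rewrite /sigma big_mkcond; apply: ler_sum => j _.
    by case: ifP => // /alpha_sorted.
  by rewrite sumr_const card_ord mulr_natr.
have head_nu : alpha k * k.+1%:R <= nu.
  rewrite le_min d_ge // andbT -[X in _ <= X]alpha_sum.
  (* The first [k.+1] letters each have probability at least [alpha k], and together at most 1. *)
  apply: (@le_trans _ _ (\sum_(j < d | (j < k.+1)%N) alpha j)); last first.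
    rewrite [X in _ <= X](bigID (fun j : 'I_d => (j < k.+1)%N)) /=.
    by rewrite lerDl sumr_ge0.
  rewrite mulr_natr -{1}[k.+1]card_ord -sumr_const.
  rewrite (big_ord_widen_cond _ (fun=> true) (fun=> alpha k) (ltn_ord k)).
  by apply: ler_sum => j; rewrite ltnS => /alpha_sorted.
have sqrt_nu s : s <= nu -> Num.sqrt (s * n%:R) <= Num.sqrt (nu * n%:R).
  by move=> snu; rewrite ler_wsqrtr // ler_wpM2r.
split=> //.
- by have := sqrt_nu _ head_nu; lra.
- by have := sqrt_nu _ sigma_nu; lra.
Qed.
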